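(* For every $\epsilon>0$, the algorithm described in the context is $(1+\epsilon)$-speed $\frac{4(1+\epsilon)^2}{\epsilon^2}$-competitive for the integral Job-Dependent Generalized Flow Time Problem, i.e. for minimizing $\sum_j w_jg_j(C_j-r_j)$, when every $g_j$ is concave and differentiable.
   Context: Online single-machine preemptive scheduling; job $j$ has release time $r_j\ge0$, processing time $p_j>0$, weight $w_j>0$ (revealed at $r_j$) and a non-decreasing cost function $g_j:[0,\infty)\to[0,\infty)$ with $g_j(0)=0$, here concave and differentiable. A schedule of speed $s$ assigns rates $x_j(t)\ge0$, $x_j(t)=0$ for $t<r_j$, $\sum_jx_j(t)\le s$; $C_j$ is the first time with $\int_{r_j}^{C_j}x_j=p_j$. An online algorithm (speed 1) is $\alpha$-speed $\beta$-competitive if its cost is at most $\beta$ times the minimum cost over offline schedules of speed $1/\alpha$. Algorithm: let $k=\lceil2/\epsilon\rceil$; order jobs by release time ($a\prec j$ if $r_a\le r_j$, ties broken arbitrarily); for a pending job $j$ at time $t$ let $G_j(t)=\sum_{a\preceq j}w_ag_a'(t-r_a)$ and $G(t)=\sum_aw_ag_a'(t-r_a)$, sums over jobs $a$ pending at $t$; process each pending job $j$ at rate $\nu_j(t)=(G_j(t)^k-G_{j+1}(t)^k)/G(t)^k$, where $j+1$ is the next pending job after $j$ in the order $\prec$ ($G_{j+1}(t)=0$ if $j$ is last).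
   Formalization: As printed, G_{j+1} ≥ G_j, so every pending job but the last gets a rate ≤ 0 (negative for two identical linear-cost jobs) and no schedule results; the rate is instead (G_j^k − G_{j−1}^k)/G^k with j−1 the preceding pending job (0 if none), and any full-speed split where G(t)=0. *)

(* Defs.v *)
From mathcomp Require Export all_boot all_order all_algebra.
From mathcomp Require Export all_classical all_reals all_analysis.
Export Order.TTheory GRing.Theory Num.Theory.
Export numFieldNormedType.Exports.

Set Implicit Arguments.
Unset Strict Implicit.
Unset Printing Implicit Defensive.

Local Open Scope classical_set_scope.
Local Open Scope ring_scope.

(* The cost functions live on [0, +oo[; their values at negative arguments are
   never used. *)
Record instance (R : realType) := Instance {
  job : finType;
  release : job -> R;
  volume : job -> R;
  weight : job -> R;
  fcost : job -> R -> R;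
  release_ge0 : forall j, 0 <= release j;
  volume_gt0 : forall j, 0 < volume j;
  weight_gt0 : forall j, 0 < weight j;
  fcost_ge0 : forall j u, 0 <= u -> 0 <= fcost j u;
  fcost_at0 : forall j, fcost j 0 = 0;
  fcost_nondecreasing :
    forall j u v, 0 <= u -> u <= v -> fcost j u <= fcost j v }.

Section Derivative.
Variables (R : realType) (g : R -> R).

(* Difference quotients relative to the domain [0, +oo[: the derivative is
   two-sided at u > 0 and one-sided at u = 0. *)
Definition quotient_filter (u : R) : set_system R :=
  (fun h => h^-1 * (g (u + h) - g u)) @ within [set h | 0 <= u + h] 0^'.

Definition differentiable_nonneg := forall u, 0 <= u -> cvg (quotient_filter u).

Definition deriv_nonneg (u : R) : R := lim (quotient_filter u).

Definition concave_nonneg :=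
  convex_function (`[0, +oo[ : set R) (fun u => - g u).

End Derivative.

Section Schedules.
Variables (R : realType) (I : instance R).
Implicit Types (x : job I -> R -> R) (s t : R) (j a : job I).

Definition work x j t : R :=
  Rintegral (@lebesgue_measure R) `[release j, t] (x j).

Definition feasible s x : Prop :=
  [/\ forall j, measurable_fun setT (x j),
      forall j t, 0 <= x j t,
      forall j t, t < release j -> x j t = 0 &
      forall t, \sum_j x j t <= s].

Definition completion_times x j : set R :=
  [set t | release j <= t /\ work x j t = volume j].

Definition completes x : Prop := forall j, completion_times x j !=set0.

Definition completion x j : R := inf (completion_times x j).

Definition total_cost x : R :=
  \sum_j weight j * fcost j (completion x j - release j).

Definition opt_cost s : \bar R :=
  ereal_inf [set (total_cost x)%:E | x in [set x | feasible s x /\ completes x]].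

Definition pending x t j : bool := (release j <= t) && (work x j t < volume j).

End Schedules.

(* The runs of an algorithm on an instance: a set, because tie-breaking may leave
   several possible schedules. *)
Definition algorithm (R : realType) :=
  forall I : instance R, set (job I -> R -> R).

Definition speed_competitive (R : realType) (K : instance R -> Prop)
    (A : algorithm R) (alpha beta : R) : Prop :=
  forall I, K I -> forall x, A I x ->
    completes x /\ ((total_cost x)%:E <= beta%:E * opt_cost I alpha^-1)%E.

Definition concave_instance (R : realType) (I : instance R) : Prop :=
  forall j : job I,
    concave_nonneg (fcost j) /\ differentiable_nonneg (fcost j).

Section Algorithm.
Variables (R : realType) (I : instance R).
Implicit Types (prec : rel (job I)) (x : job I -> R -> R) (t : R) (j a : job I).

(* A (reflexive) total order by release times, with arbitrary tie-breaking. *)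
Definition release_order prec : Prop :=
  [/\ total prec, antisymmetric prec, transitive prec &
      forall a j, prec a j -> release a <= release j].

Definition marginal a t : R :=
  weight a * deriv_nonneg (fcost a) (t - release a).

Definition Gupto prec x t j : R :=
  \sum_(a | pending x t a && prec a j) marginal a t.

Definition Gall x t : R := \sum_(a | pending x t a) marginal a t.

Definition adjacent_before prec x t j a : bool :=
  [&& pending x t a, prec a j, a != j &
      [forall b, (pending x t b && prec b j && (b != j)) ==> prec b a]].

(* Gupto increases along prec, so the rate of j is the increment of Gupto^k over
   the pending job adjacent to j on the side of earlier releases, if any. *)
Definition Gadjacent prec x t j : R :=
  if [pick a | adjacent_before prec x t j a] is Some a
  then Gupto prec x t a else 0.

Definition rate prec (k : nat) x t j : R :=
  (Gupto prec x t j ^+ k - Gadjacent prec x t j ^+ k) / Gall x t ^+ k.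

(* If Gall vanishes while jobs are pending, the rates have the form 0/0; any
   split of the unit speed among the pending jobs is then allowed.  (For
   Gall != 0 the rates of the pending jobs add up to 1 anyway.) *)
Definition follows_rates prec (k : nat) x : Prop :=
  forall t,
    [/\ forall j, ~~ pending x t j -> x j t = 0,
        Gall x t != 0 -> forall j, pending x t j -> x j t = rate prec k x t j &
        Gall x t = 0 -> (exists j, pending x t j) -> \sum_j x j t = 1].

Definition rate_algorithm_runs (k : nat) : set (job I -> R -> R) :=
  [set x | feasible 1 x /\
           exists prec, release_order prec /\ follows_rates prec k x].

End Algorithm.

Definition rate_algorithm (R : realType) (k : nat) : algorithm R :=
  fun I => @rate_algorithm_runs R I k.

(* Main.v *)
Require Import Defs.
From mathcomp Require Import measurable_realfun.
From mathcomp Require Import ring lra.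

Set Implicit Arguments.
Unset Strict Implicit.
Unset Printing Implicit Defensive.

(** Dual fitting.  A feasible dual solution is given by prices [lam_j] of the
    jobs and [gam t] of the machine with
    [lam_j <= c w_j g_j(t - r_j) + p_j gam t] for all [t >= r_j]; integrating
    this inequality against an offline schedule of speed [s] yields
    [sum_j lam_j <= c OPT + s int gam].  Take [c = k], [gam = G] and
    [lam_j = int x_j G_j].  The constraint holds because [x_j G_j] is at most
    [k w_j g_j'] (mean value bound for [y^k]) and because [G_j(u) <= G(t)] for
    [r_j <= t <= u], by concavity.  The telescoping form of the rates gives
    [sum_j x_j G_j >= k/(k+1) G], while [int G] is the cost of the algorithm, so
    that [(k/(k+1) - s) ALG <= k OPT]. *)

Local Open Scope classical_set_scope.
Local Open Scope ring_scope.

(** * Integrals of bounded measurable functions over bounded intervals *)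

Section BoundedMeasurable.
Variable R : realType.
Implicit Types (f g : R -> R) (a b c : R).
Local Notation mu := (@lebesgue_measure R).

(** All integrands below lie in this class. It is closed under sums and products and integrable on
    bounded intervals, so integrability conditions are settled by the shape of the integrand. *)
Definition bounded_mfun f :=
  measurable_fun setT f /\ exists K, forall t, `|f t| <= K.

Lemma bounded_mfun_cst c : bounded_mfun (fun=> c).
Proof. by split; [exact: measurable_cst | exists `|c|]. Qed.

Lemma bounded_mfunD f g :
  bounded_mfun f -> bounded_mfun g -> bounded_mfun (fun t => f t + g t).
Proof.
move=> [mf [K fK]] [mg [L gL]]; split; first exact: measurable_funD.
by exists (K + L) => t; rewrite (le_trans (ler_normD _ _))// lerD.
Qed.

Lemma bounded_mfunM f g :
  bounded_mfun f -> bounded_mfun g -> bounded_mfun (fun t => f t * g t).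
Proof.
move=> [mf [K fK]] [mg [L gL]]; split; first exact: measurable_funM.
by exists (K * L) => t; rewrite normrM ler_pM.
Qed.

Lemma bounded_mfun_sum (T : Type) (s : seq T) (P : pred T) (F : T -> R -> R) :
  (forall i, bounded_mfun (F i)) ->
  bounded_mfun (fun t => \sum_(i <- s | P i) F i t).
Proof.
move=> bF; elim: s => [|i s IH].
  by under eq_fun do rewrite big_nil; exact: bounded_mfun_cst.
case: (boolP (P i)) => Pi; under eq_fun do rewrite big_cons ?Pi ?(negbTE Pi).
  exact: bounded_mfunD.
exact: IH.
Qed.

Lemma bounded_mfun_indic (A : set R) : measurable A -> bounded_mfun \1_A.
Proof.
move=> mA; split; first exact: measurable_indic.
exists 1 => t; rewrite indicE ger0_norm ?ler0n//.
by rewrite -[leRHS]/(1%:R) ler_nat leq_b1.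
Qed.

Lemma bounded_mfun_integrable f (i : interval R) a b :
  [set` i] `<=` `[a, b] -> bounded_mfun f ->
  mu.-integrable [set` i] (EFin \o f).
Proof.
move=> iab [mf [K fK]].
apply: (@integrableS _ _ _ mu `[a, b]) => //.
apply: measurable_bounded_integrable => //.
- by rewrite /= lebesgue_measure_itv/=; case: ifPn => // _; rewrite -EFinB ltry.
- exact: measurable_funS mf.
- exists `|K|; split; first by rewrite num_real.
  move=> M KM t _ /=; rewrite (le_trans (fK t))// (le_trans _ (ltW KM))//.
  exact: ler_norm.
Qed.

Lemma bounded_mfun_integrable_cc f a b :
  bounded_mfun f -> mu.-integrable `[a, b] (EFin \o f).
Proof. by apply: bounded_mfun_integrable; exact: subset_refl. Qed.

Hint Resolve bounded_mfun_integrable_cc : core.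

Lemma integral_split f a b c : bounded_mfun f -> a <= b -> b <= c ->
  \int[mu]_(t in `[a, c]) f t =
  \int[mu]_(t in `[a, b]) f t + \int[mu]_(t in `[b, c]) f t.
Proof.
move=> bf ab bc.
have := @Rintegral_itvB R f (BLeft a) (BRight c) b.
rewrite !bnd_simp => /(_ (bounded_mfun_integrable_cc _ _ bf) ab bc).
rewrite Rintegral_itv_obnd_cbnd; last first.
  apply: (@bounded_mfun_integrable _ _ b c) => //.
  by apply: subset_itvr; rewrite bnd_simp.
by move=> <-; rewrite addrC subrK.
Qed.

Lemma integral_le f g a b : bounded_mfun f -> bounded_mfun g ->
  (forall t, a <= t <= b -> f t <= g t) ->
  \int[mu]_(t in `[a, b]) f t <= \int[mu]_(t in `[a, b]) g t.
Proof.
move=> bf bg fg; apply: le_Rintegral; [by []|by auto|by auto|].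
by move=> t /=; rewrite in_itv/=; exact: fg.
Qed.

(** End points are null sets. This form serves comparisons that may fail exactly at a release or
    completion time. *)
Lemma integral_le_oo f g a b : bounded_mfun f -> bounded_mfun g ->
  (forall t, a < t < b -> f t <= g t) ->
  \int[mu]_(t in `[a, b]) f t <= \int[mu]_(t in `[a, b]) g t.
Proof.
move=> bf bg fg.
have oo h : bounded_mfun h ->
  \int[mu]_(t in `[a, b]) h t = \int[mu]_(t in `]a, b[) h t.
  move=> bh; rewrite -Rintegral_itv_bndo_bndc; last first.
    apply: (@bounded_mfun_integrable _ _ a b) => //.
    by apply: subset_itvl; rewrite bnd_simp.
  rewrite -Rintegral_itv_obnd_cbnd//.
  apply: (@bounded_mfun_integrable _ _ a b) => //.
  by apply: subset_itv; rewrite bnd_simp.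
have io h : bounded_mfun h -> mu.-integrable `]a, b[ (EFin \o h).
  apply: (@bounded_mfun_integrable _ _ a b) => //.
  by apply: subset_itv; rewrite bnd_simp.
rewrite !oo//; apply: le_Rintegral; [by []|by auto|by auto|].
by move=> t /=; rewrite in_itv/=; exact: fg.
Qed.

Lemma integral_ge0 f a b : (forall t, a <= t <= b -> 0 <= f t) ->
  0 <= \int[mu]_(t in `[a, b]) f t.
Proof. by move=> f0; apply: Rintegral_ge0 => t /=; rewrite in_itv; exact: f0. Qed.

Lemma integral_cst a b c : a <= b -> \int[mu]_(t in `[a, b]) c = c * (b - a).
Proof.
move=> ab; rewrite Rintegral_cst//= lebesgue_measure_itv/= lte_fin.
by move: ab; rewrite le_eqVlt => /predU1P[->|->//]; rewrite ltxx subrr.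
Qed.

Lemma integralD f g a b : bounded_mfun f -> bounded_mfun g ->
  \int[mu]_(t in `[a, b]) (f t + g t) =
  \int[mu]_(t in `[a, b]) f t + \int[mu]_(t in `[a, b]) g t.
Proof. by move=> bf bg; apply: RintegralD; auto. Qed.

Lemma integralZ f a b c : bounded_mfun f ->
  \int[mu]_(t in `[a, b]) (c * f t) = c * \int[mu]_(t in `[a, b]) f t.
Proof. by move=> bf; apply: RintegralZl; auto. Qed.

Lemma integral_sum (T : Type) (s : seq T) (P : pred T) (F : T -> R -> R) a b :
  (forall i, bounded_mfun (F i)) ->
  \int[mu]_(t in `[a, b]) (\sum_(i <- s | P i) F i t) =
  \sum_(i <- s | P i) \int[mu]_(t in `[a, b]) F i t.
Proof.
move=> bF; elim: s => [|i s IH].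
  under eq_Rintegral do rewrite big_nil.
  by rewrite big_nil Rintegral_cst//= mul0r.
rewrite big_cons -IH; case: (boolP (P i)) => Pi.
  under eq_Rintegral do rewrite big_cons Pi.
  by rewrite integralD//; exact: bounded_mfun_sum.
by under eq_Rintegral do rewrite big_cons (negbTE Pi).
Qed.

Lemma integral_extend f a b c d : bounded_mfun f -> (forall t, 0 <= f t) ->
  c <= a -> a <= b -> b <= d ->
  \int[mu]_(t in `[a, b]) f t <= \int[mu]_(t in `[c, d]) f t.
Proof.
move=> bf f0 ca ab bd.
rewrite (integral_split bf ca (le_trans ab bd)) (integral_split bf ab bd).
by rewrite addrA -addrA addrCA lerDl addr_ge0// integral_ge0.
Qed.

End BoundedMeasurable.
#[export] Hint Resolve bounded_mfun_integrable_cc : core.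

(** * Telescoping along a finite total order *)

Section OrderSums.
Variables (T : finType) (prec : rel T).
Hypotheses (prec_total : total prec) (prec_anti : antisymmetric prec)
  (prec_trans : transitive prec).
Implicit Types (P : pred T).

Let prec_refl : reflexive prec.
Proof. by move=> a; move: (prec_total a a); rewrite orbb. Qed.

Lemma pred_has_last P a0 : P a0 ->
  exists2 m, P m & forall a, P a -> prec a m.
Proof.
move=> Pa0.
have ge_refl : reflexive (fun a b => prec b a) by [].
have ge_trans : transitive (fun a b => prec b a).
  by move=> b a c /= ba cb; exact: prec_trans cb ba.
have ge_total : total (fun a b => prec b a) by move=> a b /=; exact: prec_total.
by case: (extremumP id ge_refl ge_trans ge_total Pa0) => m; exists m.
Qed.

(** Induction on the size of [P], removing its last element [z]: the term of [z] is [F] of the full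
    sum minus [F] of the sum without [z], and no other prefix contains [z]. [F] stays arbitrary
    because both [y ^+ k] and [y ^+ k.+1] are telescoped later. *)
Lemma sum_increments (R : zmodType) (m : T -> R) (F : R -> R) P :
  \sum_(j | P j) (F (\sum_(a | P a && prec a j) m a) -
                  F (\sum_(a | [&& P a, prec a j & a != j]) m a)) =
  F (\sum_(a | P a) m a) - F 0.
Proof.
have [n] := ubnP #|P|; elim: n P => // n IH P leP.
have [Pn|[a0 Pa0]] : (forall a, ~~ P a) \/ (exists a, P a).
  by case: (pickP P) => [a|P0]; [right; exists a | left=> a; rewrite P0].
  by rewrite !big1 ?subrr// => a Pa; move: (Pn a); rewrite Pa.
have [z Pz lastz] := pred_has_last Pa0.
rewrite (bigD1 z)//= addrC.
set Q := fun a => P a && (a != z).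
have -> : \sum_(a | P a && prec a z) m a = \sum_(a | P a) m a.
  by apply: eq_bigl => a; case: (boolP (P a)) => //= /lastz ->.
have -> : \sum_(a | [&& P a, prec a z & a != z]) m a = \sum_(a | Q a) m a.
  by apply: eq_bigl => a; rewrite /Q; case: (boolP (P a)) => //= /lastz ->.
rewrite (eq_bigr (fun j => F (\sum_(a | Q a && prec a j) m a) -
   F (\sum_(a | [&& Q a, prec a j & a != j]) m a))); last first.
  move=> j /andP[Pj jz].
  have zj : prec z j = false.
    apply: contraNF jz => zj; apply/eqP/prec_anti.
    by rewrite zj lastz.
  by congr (F _ - F _); apply: eq_bigl => a; rewrite /Q;
    have [->|//] := eqVneq a z; rewrite ?zj ?andbF ?andbT.
rewrite (IH Q); last first.
  move: leP; rewrite (cardD1 z) -topredE /= Pz ltnS; apply: leq_ltn_trans.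
  apply: subset_leq_card; apply/fintype.subsetP => a.
  rewrite -!topredE /= => /andP[Pa az]; rewrite az; exact: Pa.
by rewrite addrC addrA subrK.
Qed.

End OrderSums.

(** * Mean value bounds for powers *)

Section PowerIneq.
Variable R : realFieldType.
Implicit Types a b : R.

(** The slope of [y ^+ k] on the interval from [a] to [b] is at most its slope at [b]; the extra
    factor [b] on both sides avoids the exponent [k - 1]. *)
Lemma subX_le_mul (k : nat) a b : 0 <= a -> a <= b ->
  b * (b ^+ k - a ^+ k) <= k%:R * (b - a) * b ^+ k.
Proof.
move=> a0 ab; have b0 := le_trans a0 ab.
elim: k => [|k IH]; first by rewrite !expr0 subrr mulr0 !mul0r.
have -> : b * (b ^+ k.+1 - a ^+ k.+1) =
  b * (b * (b ^+ k - a ^+ k)) + b * (b - a) * a ^+ k by rewrite !exprS; ring.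
have -> : k.+1%:R * (b - a) * b ^+ k.+1 =
  b * (k%:R * (b - a) * b ^+ k) + b * (b - a) * b ^+ k.
  by rewrite -natr1 !exprS; ring.
apply: lerD; first exact: ler_wpM2l.
apply: ler_wpM2l; first by rewrite mulr_ge0// subr_ge0.
by apply: lerXn2r => //; rewrite nnegrE.
Qed.

(** In integral form: the integral of [y] against d(y^k) from [a] to [b] equals k/(k+1) times the
    increment of y^(k+1), and replacing [y] by its largest value [b] only increases it. *)
Lemma mul_subX_ge (k : nat) a b : 0 <= a -> a <= b ->
  k%:R * (b ^+ k.+1 - a ^+ k.+1) <= k.+1%:R * (b * (b ^+ k - a ^+ k)).
Proof.
move=> a0 ab; have b0 := le_trans a0 ab.
(* The difference of the two sides of the claim is exactly the difference of the two sides of this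
   bound. *)
have H : (k%:R * (b - a)) * a ^+ k <= b * (b ^+ k - a ^+ k).
  elim: k => [|k IH]; first by rewrite !expr0 subrr mulr0 !mul0r.
  have -> : b * (b ^+ k.+1 - a ^+ k.+1) =
    b * (b * (b ^+ k - a ^+ k)) + b * (b - a) * a ^+ k by rewrite !exprS; ring.
  have -> : k.+1%:R * (b - a) * a ^+ k.+1 =
    a * (k%:R * (b - a) * a ^+ k) + a * (b - a) * a ^+ k.
    by rewrite -natr1 !exprS; ring.
  have h0 : 0 <= k%:R * (b - a) * a ^+ k.
    by rewrite !mulr_ge0// ?ler0n ?subr_ge0 ?exprn_ge0.
  apply: lerD; last first.
    by rewrite -!mulrA ler_wpM2r// mulr_ge0 ?subr_ge0 ?exprn_ge0.
  by apply: ler_pM.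
rewrite -subr_ge0 in H; rewrite -subr_ge0.
have -> // : k.+1%:R * (b * (b ^+ k - a ^+ k)) - k%:R * (b ^+ k.+1 - a ^+ k.+1) =
  b * (b ^+ k - a ^+ k) - k%:R * (b - a) * a ^+ k.
by rewrite -natr1 !exprS; ring.
Qed.

End PowerIneq.

(** * Recovering [F] by integrating a function [f] that bounds its chord slopes *)

Section IntegralOfSlopes.
Variables (R : realType) (f F : R -> R) (r : R).
Hypothesis f_bm : bounded_mfun f.
Hypothesis slopes : forall u v, r <= u -> u <= v ->
  f v * (v - u) <= F v - F u <= f u * (v - u).
Local Notation mu := (@lebesgue_measure R).

Lemma slopes_nonincreasing u v : r <= u -> u <= v -> f v <= f u.
Proof.
move=> ru; rewrite le_eqVlt => /predU1P[->//|uv].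
have /andP[lo hi] := slopes ru (ltW uv).
by rewrite -(ler_pM2r (x := v - u)) ?subr_gt0// (le_trans lo hi).
Qed.

(* Halving the interval halves the error bound, since the bound is proportional
   both to the length and to the drop of [f]. *)
Lemma integral_slopes_error n a b : r <= a -> a <= b ->
  `|\int[mu]_(t in `[a, b]) f t - (F b - F a)| * 2 ^+ n <=
  (b - a) * (f a - f b).
Proof.
elim: n a b => [|n IH] a b ra ab.
  (* Base case: the integral and [F b - F a] both lie between [f b * (b - a)] and
     [f a * (b - a)]. *)
  have /andP[lo hi] := slopes ra ab.
  have I1 : \int[mu]_(t in `[a, b]) f t <= f a * (b - a).
    rewrite -integral_cst//; apply: integral_le => //.
      exact: bounded_mfun_cst.
    by move=> t /andP[at_ tb]; exact: slopes_nonincreasing.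
  have I2 : f b * (b - a) <= \int[mu]_(t in `[a, b]) f t.
    rewrite -integral_cst//; apply: integral_le => //.
      exact: bounded_mfun_cst.
    move=> t /andP[at_ tb]; apply: slopes_nonincreasing => //.
    exact: le_trans at_.
  rewrite expr0 mulr1 ler_norml; move: I1 I2 lo hi.
  rewrite mulrBr ![_ * (b - a)]mulrC; set X := Rintegral _ _ _.
  by move=> *; lra.
have := midf_le ab => -[am mb]; set m := (a + b) / 2 in am mb.
have rm := le_trans ra am.
have E1 : m - a = (b - a) / 2 by rewrite /m; field.
have E2 : b - m = (b - a) / 2 by rewrite /m; field.
have H1 := IH _ _ ra am; have H2 := IH _ _ rm mb.
rewrite {}E1 in H1; rewrite {}E2 in H2.
rewrite (integral_split f_bm am mb).
set X := \int[mu]_(t in `[a, m]) f t in H1 *.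
set Y := \int[mu]_(t in `[m, b]) f t in H2 *.
have -> : X + Y - (F b - F a) = X - (F m - F a) + (Y - (F b - F m)) by ring.
apply: (@le_trans _ _ (2 * ((`|X - (F m - F a)| + `|Y - (F b - F m)|) * 2 ^+ n))).
  rewrite exprS mulrCA ler_pM2l ?ltr0n// ler_pM2r ?exprn_gt0 ?ltr0n//.
  exact: ler_normD.
have -> : (b - a) * (f a - f b) =
  2 * ((b - a) / 2 * (f a - f m) + (b - a) / 2 * (f m - f b)) by field.
by rewrite ler_pM2l ?ltr0n// mulrDl lerD.
Qed.

(** The error is at most a constant over [2 ^+ n] for every [n]. A nonzero error would contradict
    this for large [n], since [n] is below [2 ^+ n]. *)
Lemma integral_slopes a b : r <= a -> a <= b ->
  \int[mu]_(t in `[a, b]) f t = F b - F a.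
Proof.
move=> ra ab; apply/eqP; rewrite -subr_eq0 -normr_eq0.
set D := `|_|.
apply/negPn/negP => D0.
have Dp : 0 < D by rewrite lt_neqAle eq_sym D0 normr_ge0.
set B := (b - a) * (f a - f b).
have [n _ nB] : exists2 n : nat, True & B < D * n%:R.
  exists (Num.truncn (B / D)).+1 => //.
  by rewrite mulrC -ltr_pdivrMr// truncnS_gt.
have := integral_slopes_error n ra ab; rewrite leNgt => /negP; apply.
apply: (lt_le_trans nB); rewrite ler_pM2l// -natrX ler_nat.
exact/ltnW/ltn_expl.
Qed.

End IntegralOfSlopes.

(** * Derivatives of concave functions on the half-line *)

Section ConcaveDerivative.
Variables (R : realType) (g : R -> R).
Hypotheses (g_concave : concave_nonneg g) (g_diff : differentiable_nonneg g).
Implicit Types u v : R.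
Local Notation mu := (@lebesgue_measure R).

Lemma quotient_near u e : 0 <= u -> 0 < e ->
  exists2 d, 0 < d & forall h, `|h| < d -> h != 0 -> 0 <= u + h ->
    `|deriv_nonneg g u - h^-1 * (g (u + h) - g u)| < e.
Proof.
move=> u0 e0.
have cv := g_diff u0.
have : nbhs (deriv_nonneg g u) (ball (deriv_nonneg g u) e) by exact: nbhsx_ballx.
move=> /cv [d /= d0 H]; exists d => // h hd hn uh.
by have := H h; rewrite /ball_ /= sub0r normrN => /(_ hd hn uh).
Qed.

Lemma concave_chord u v th : 0 <= u -> 0 <= v -> 0 <= th <= 1 ->
  th * (g v - g u) <= g (u + th * (v - u)) - g u.
Proof.
move=> u0 v0 /andP[th0 th1].
have H : - g (th * v + (1 - th) * u) <= th * - g v + (1 - th) * - g u.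
  have := g_concave (Itv01 th0 th1) (x := v) (y := u).
  by rewrite !inE/= !in_itv/= !andbT => /(_ v0 u0).
have -> : u + th * (v - u) = th * v + (1 - th) * u by ring.
move: H; set G := g (_ + _); rewrite !mulrN mulrBl mulrBr; lra.
Qed.

(** By concavity, moving a fraction [th] of the way from [u] to [v] gains at least
    [th * (g v - g u)]. If [g v] lay above the tangent at [u], the difference quotients at [u] would
    stay away from their limit. *)
Lemma concave_tangent u v : 0 <= u -> 0 <= v ->
  g v - g u <= deriv_nonneg g u * (v - u).
Proof.
move=> u0 v0; have [->|vu] := eqVneq v u; first by rewrite !subrr mulr0.
have w0 : 0 < `|v - u| by rewrite normr_gt0 subr_eq0.
rewrite leNgt; apply/negP => lt_g.
set D := deriv_nonneg g u in lt_g *.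
(* The tolerance is the supposed excess over the tangent per unit of length. *)
have e0 : 0 < (g v - g u - D * (v - u)) / `|v - u|.
  by rewrite divr_gt0// subr_gt0.
have [d d0 Hd] := quotient_near u0 e0.
(* The cap 1 is for the chord bound; the half makes the step strictly shorter than [d]. *)
pose th := Num.min 1 (d / 2 / `|v - u|).
have th0 : 0 < th by rewrite lt_min ltr01 !divr_gt0.
have th1 : th <= 1 by rewrite ge_min lexx.
have ch : th * (g v - g u) <= g (u + th * (v - u)) - g u.
  by apply: concave_chord => //; rewrite (ltW th0).
have uh : 0 <= u + th * (v - u).
  have -> : u + th * (v - u) = th * v + (1 - th) * u by ring.
  by rewrite addr_ge0// mulr_ge0// ?subr_ge0// ltW.
have hn : th * (v - u) != 0.
  by rewrite mulf_eq0 negb_or subr_eq0 vu (gt_eqF th0).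
have hd : `|th * (v - u)| < d.
  rewrite normrM (gtr0_norm th0) -ltr_pdivlMr//.
  apply: (@le_lt_trans _ _ (d / 2 / `|v - u|)); first by rewrite ge_min lexx orbT.
  by rewrite ltr_pM2r ?invr_gt0// ltr_pdivrMr ?ltr0n// mulr_natr mulr2n ltrDl.
have := Hd _ hd hn uh; rewrite ltr_pdivlMr// -normrM -/D.
set Q := g (u + th * (v - u)) - g u in ch *.
have vu0 : v - u != 0 by rewrite subr_eq0.
have -> : (D - (th * (v - u))^-1 * Q) * (v - u) = D * (v - u) - Q / th.
  have thn : th != 0 by rewrite gt_eqF.
  field.
  by rewrite thn.

have : g v - g u <= Q / th by rewrite ler_pdivlMr// mulrC.
rewrite ltr_norml => ? /andP[? ?]; lra.
Qed.

Hypothesis g_nd : forall u v, 0 <= u -> u <= v -> g u <= g v.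

Lemma deriv_nonneg_ge0 u : 0 <= u -> 0 <= deriv_nonneg g u.
Proof.
move=> u0; have u1 : 0 <= u + 1 by rewrite addr_ge0.
have := concave_tangent u0 u1; have -> : u + 1 - u = 1 by ring.
rewrite mulr1.
by apply: le_trans; rewrite subr_ge0 g_nd// lerDl.
Qed.

Lemma deriv_nonneg_nonincreasing u v : 0 <= u -> u <= v ->
  deriv_nonneg g v <= deriv_nonneg g u.
Proof.
move=> u0; rewrite le_eqVlt => /predU1P[->//|uv].
have v0 := le_trans u0 (ltW uv).
have h1 := concave_tangent u0 v0; have h2 := concave_tangent v0 u0.
rewrite -(ler_pM2r (x := v - u)) ?subr_gt0//; apply: le_trans h1.
by move: h2; rewrite -(opprB v u) mulrN -(opprB (g v)) lerN2.
Qed.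

(** Clamping the argument at 0 makes the function nonincreasing on the whole line, hence measurable,
    and bounded by the derivative at 0. *)
Lemma bounded_mfun_deriv r :
  bounded_mfun (fun t => deriv_nonneg g (Num.max 0 (t - r))).
Proof.
have ge0 t : 0 <= Num.max 0 (t - r) by rewrite le_max lexx.
split; last first.
  exists (deriv_nonneg g 0) => t.
  by rewrite ger0_norm ?deriv_nonneg_ge0 ?deriv_nonneg_nonincreasing.
apply: nonincreasing_measurable => // s t st.
apply: deriv_nonneg_nonincreasing => //.
by rewrite ge_max ge0 le_max lerD2r st orbT.
Qed.

(** The tangent inequalities at the two ends of an interval are precisely the slope bounds required
    by [integral_slopes]. *)
Lemma integral_deriv r a b : r <= a -> a <= b ->
  \int[mu]_(t in `[a, b]) deriv_nonneg g (Num.max 0 (t - r)) =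
  g (b - r) - g (a - r).
Proof.
apply: (@integral_slopes _ _ (fun t => g (t - r))); first exact: bounded_mfun_deriv.
move=> u v ru uv; have rv := le_trans ru uv.
have u0 : 0 <= u - r by rewrite subr_ge0.
have v0 : 0 <= v - r by rewrite subr_ge0.
rewrite !max_r//; apply/andP; split.
  have := concave_tangent v0 u0; have -> : u - r - (v - r) = u - v by ring.
  by rewrite -(opprB v u) mulrN -(opprB (g (v - r))) lerN2.
by have := concave_tangent u0 v0; have -> : v - r - (u - r) = v - u by ring.
Qed.

End ConcaveDerivative.

(** * Work and completion times in a feasible schedule *)

Section FeasibleSchedule.
Variables (R : realType) (I : instance R) (s : R) (x : job I -> R -> R).
Hypothesis x_feas : feasible s x.
Implicit Types (j a : job I) (t u v : R).
Local Notation mu := (@lebesgue_measure R).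

Lemma schedule_ge0 j t : 0 <= x j t.
Proof. by case: x_feas. Qed.

Lemma schedule_le j t : x j t <= s.
Proof.
case: x_feas => _ x0 _ /(_ t); apply: le_trans.
by rewrite (bigD1 j)//= lerDl sumr_ge0.
Qed.

Lemma bounded_mfun_schedule j : bounded_mfun (x j).
Proof.
split; first by case: x_feas.
by exists s => t; rewrite ger0_norm ?schedule_ge0 ?schedule_le.
Qed.

Lemma workD j u v : release j <= u -> u <= v ->
  work x j v = work x j u + \int[mu]_(t in `[u, v]) x j t.
Proof. by move=> ru uv; exact: integral_split (bounded_mfun_schedule j) ru uv. Qed.

Lemma work_nondecreasing j u v : release j <= u -> u <= v ->
  work x j u <= work x j v.
Proof.
move=> ru uv; rewrite (workD ru uv) lerDl integral_ge0// => t _.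
exact: schedule_ge0.
Qed.

Lemma work_lipschitz j u v : release j <= u -> u <= v ->
  work x j v <= work x j u + s * (v - u).
Proof.
move=> ru uv; rewrite (workD ru uv) lerD2l -integral_cst//.
apply: integral_le; [exact: bounded_mfun_schedule|exact: bounded_mfun_cst|].
by move=> t _; exact: schedule_le.
Qed.

Lemma work_release j : work x j (release j) = 0.
Proof. by rewrite /work set_itv1 Rintegral_set1. Qed.

(** Intermediate value theorem: the work is a continuous primitive starting at 0. *)
Lemma work_reaches j t : release j <= t -> volume j <= work x j t ->
  exists2 c, release j <= c <= t & work x j c = volume j.
Proof.
move=> rt vt.
have cont : {within `[release j, t], continuous (work x j)}.
  apply: parameterized_integral_continuous => //.
  exact/bounded_mfun_integrable_cc/bounded_mfun_schedule.
have [|c] := IVT (v := volume j) rt cont.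
  by rewrite work_release ge_min le_max vt orbT (ltW (volume_gt0 j)).
by rewrite in_itv /= => rc wc; exists c.
Qed.

Lemma completion_lbound j t : completion_times x j t -> completion x j <= t.
Proof.
move=> ct; apply: ge_inf => //.
by exists (release j) => u [].
Qed.

Lemma release_le_completion j : completion_times x j !=set0 ->
  release j <= completion x j.
Proof. by move=> ne; apply: lb_le_inf => // u []. Qed.

(** Monotonicity of the work gives one inequality. For the other, completion times come arbitrarily
    close to the infimum, and the work grows at speed at most [s]. *)
Lemma completion_attained j : completion_times x j !=set0 ->
  completion_times x j (completion x j).
Proof.
move=> ne; have rC := release_le_completion ne.
split=> //; apply/eqP; rewrite eq_le; apply/andP; split.
  have [T TC] := ne; have [_ <-] := TC.
  exact: work_nondecreasing (completion_lbound TC).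
apply/ler_addgt0Pr => e e0.
have s0 : 0 <= s by apply: le_trans (schedule_le j 0); exact: schedule_ge0.
(* Dividing by [s + 1] keeps the divisor positive without a separate case [s = 0]. *)
have s1 : 0 < s + 1 by rewrite ltr_wpDl.
have hi : has_inf (completion_times x j).
  by split=> //; exists (release j) => u [].
have [T TC TCe] := inf_adherent (divr_gt0 e0 s1) hi.
have CT := completion_lbound TC.
have := work_lipschitz rC CT; have [_ ->] := TC; move/le_trans; apply.
rewrite lerD2l; apply: (@le_trans _ _ ((s + 1) * (e / (s + 1)))).
  apply: ler_pM; rewrite ?subr_ge0 ?lerDl// lerBlDl; exact: ltW.
by rewrite mulrC divfK// gt_eqF.
Qed.

Lemma pending_before j t u : release j <= t -> t <= u -> pending x u j ->
  pending x t j.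
Proof.
move=> rt tu /andP[_ lt_v]; rewrite /pending rt /=.
exact: le_lt_trans (work_nondecreasing rt tu) lt_v.
Qed.

(** The pending times of a job form an interval. *)
Lemma measurable_pending j : measurable [set t | pending x t j].
Proof.
apply: is_interval_measurable => u v /= pu pv w /andP[uw wv].
apply: pending_before wv pv; case/andP: pu => ru _; exact: le_trans uw.
Qed.

End FeasibleSchedule.

(** * Pointwise properties of the rates, and completion of all jobs *)

Section Run.
Variables (R : realType) (I : instance R) (k : nat) (prec : rel (job I)).
Variable x : job I -> R -> R.
Hypotheses (k_gt0 : (0 < k)%N) (I_concave : concave_instance I)
  (x_feas : feasible 1 x) (prec_order : release_order prec)
  (x_rates : follows_rates prec k x).
Implicit Types (j a : job I) (t u v : R).
Local Notation mu := (@lebesgue_measure R).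

Lemma marginal_ge0 a t : release a <= t -> 0 <= marginal a t.
Proof.
move=> rt; have [conc diff] := I_concave a.
apply: mulr_ge0; first exact/ltW/weight_gt0.
apply: deriv_nonneg_ge0 => //; first exact: fcost_nondecreasing.
by rewrite subr_ge0.
Qed.

Lemma marginal_nonincreasing a t u : release a <= t -> t <= u ->
  marginal a u <= marginal a t.
Proof.
move=> rt tu; have [conc diff] := I_concave a.
apply: ler_wpM2l; first exact/ltW/weight_gt0.
by apply: deriv_nonneg_nonincreasing; rewrite ?subr_ge0// lerD2r.
Qed.

Lemma pending_marginal_ge0 a t : pending x t a -> 0 <= marginal a t.
Proof. by case/andP => ra _; exact: marginal_ge0. Qed.

(** The adjacent job is the last pending one strictly before [j], so its prefix consists of all of
    them; without such a job both sides are 0. This puts the rates in the form telescoped by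
    [sum_increments]. *)
Lemma GadjacentE t j : pending x t j ->
  Gadjacent prec x t j =
  \sum_(a | [&& pending x t a, prec a j & a != j]) marginal a t.
Proof.
have [tot anti trans _] := prec_order.
move=> pj; rewrite /Gadjacent; case: pickP => [a|none].
  move=> /and4P[pa aj naj /forallP last_a]; apply: eq_bigl => b.
  apply/andP/and3P => [[pb ba]|[pb bj nbj]].
    split=> //; first exact: trans ba aj.
    apply: contraNneq naj => bj; apply/eqP/anti.
    by rewrite aj -[j in prec j a]bj ba.
  by split=> //; move/implyP: (last_a b); apply; rewrite pb bj nbj.
rewrite big_pred0// => b; apply/negP => b_before.
have [m /and3P[pm mj nmj] last_m] :=
  pred_has_last (P := fun a => [&& pending x t a, prec a j & a != j])
    tot trans b_before.
move: (none m); rewrite /adjacent_before pm mj nmj /= => /negP; apply.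
apply/forallP => c; apply/implyP => /andP[/andP[pc cj] ncj].
by apply: last_m; rewrite pc cj.
Qed.

Lemma Gupto_le_Gall t j : Gupto prec x t j <= Gall x t.
Proof.
rewrite /Gall (bigID (fun a => prec a j))/= lerDl.
by apply: sumr_ge0 => a /andP[pa _]; exact: pending_marginal_ge0.
Qed.

Lemma Gadjacent_ge0 t j : pending x t j -> 0 <= Gadjacent prec x t j.
Proof.
move=> pj; rewrite GadjacentE//; apply: sumr_ge0 => a /and3P[pa _ _].
exact: pending_marginal_ge0.
Qed.

Lemma Gupto_marginalD t j : pending x t j ->
  Gupto prec x t j = marginal j t + Gadjacent prec x t j.
Proof.
have [tot _ _ _] := prec_order.
move=> pj; rewrite GadjacentE// /Gupto (bigD1 j)/=; last first.
  by rewrite pj; move: (tot j j); rewrite orbb.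
by congr (_ + _); apply: eq_bigl => a; rewrite andbA.
Qed.

Lemma Gadjacent_le_Gupto t j : pending x t j ->
  Gadjacent prec x t j <= Gupto prec x t j.
Proof. by move=> pj; rewrite Gupto_marginalD// lerDr pending_marginal_ge0. Qed.

Lemma Gall_ge0 t : 0 <= Gall x t.
Proof. by apply: sumr_ge0 => a; exact: pending_marginal_ge0. Qed.

Lemma Gupto_ge0 t j : 0 <= Gupto prec x t j.
Proof. by apply: sumr_ge0 => a /andP[pa _]; exact: pending_marginal_ge0. Qed.

Lemma sum_G_increments t (F : R -> R) :
  \sum_(j | pending x t j)
    (F (Gupto prec x t j) - F (Gadjacent prec x t j)) = F (Gall x t) - F 0.
Proof.
have [tot anti trans _] := prec_order.
rewrite /Gall -(sum_increments tot anti trans).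
by apply: eq_bigr => j pj; rewrite GadjacentE.
Qed.

Lemma sum_schedule_pending t (F : job I -> R) :
  \sum_j x j t * F j = \sum_(j | pending x t j) x j t * F j.
Proof.
rewrite (bigID (pending x t))/= [X in _ + X]big1 ?addr0// => j npj.
by have [-> //] := x_rates t; rewrite mul0r.
Qed.

(** The numerators of the rates telescope to [Gall x t ^+ k], using [0 ^+ k = 0] for positive [k].
    When [Gall] vanishes, the run is at full speed by definition. *)
Lemma full_speed t j : pending x t j -> \sum_j x j t = 1.
Proof.
move=> pj; have [_ rates zero] := x_rates t.
have [G0|G0] := eqVneq (Gall x t) 0; first by apply: zero => //; exists j.
under eq_bigr do rewrite -[x _ _]mulr1.
rewrite (sum_schedule_pending t (fun=> 1)).
under eq_bigr => i pi do rewrite mulr1 rates// /rate.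
rewrite -mulr_suml (sum_G_increments t (fun y => y ^+ k)).
by rewrite expr0n eqn0Ngt k_gt0 subr0 divff// expf_neq0.
Qed.

Lemma sum_dual_rates_ge t :
  k%:R * Gall x t <= k.+1%:R * \sum_j x j t * Gupto prec x t j.
Proof.
have [_ rates zero] := x_rates t.
have [G0|G0] := eqVneq (Gall x t) 0.
  rewrite G0 mulr0 mulr_ge0// sumr_ge0// => j _.
  by rewrite mulr_ge0 ?Gupto_ge0// (schedule_ge0 x_feas).
have Gk0 : 0 < Gall x t ^+ k by rewrite exprn_gt0// lt_neqAle eq_sym G0 Gall_ge0.
rewrite (sum_schedule_pending t (Gupto prec x t)).
(* Multiplying by [Gall x t ^+ k] clears the denominators of the rates and turns the left side into
   a multiple of [Gall x t ^+ k.+1]. That power splits into increments, one per pending job, to be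
   compared term by term. *)
rewrite -(ler_pM2r Gk0) -mulrA -exprS -[_ ^+ k.+1]subr0.
have {1}<- : (0 : R) ^+ k.+1 = 0 by rewrite expr0n.
rewrite -(sum_G_increments t (fun y => y ^+ k.+1)).
rewrite -mulrA mulr_suml !mulr_sumr; apply: ler_sum => j pj.
rewrite rates// /rate mulrAC divfK ?gt_eqF// [_ * Gupto _ _ _ _]mulrC.
apply: mul_subX_ge; [exact: Gadjacent_ge0|exact: Gadjacent_le_Gupto].
Qed.

Lemma dual_rate_le t j : pending x t j ->
  x j t * Gupto prec x t j <= k%:R * marginal j t.
Proof.
move=> pj; have [_ rates _] := x_rates t.
have km0 : 0 <= k%:R * marginal j t by rewrite mulr_ge0// pending_marginal_ge0.
(* If [Gall] vanishes the rate of [j] is unspecified, but [Gupto] lies between 0 and [Gall] and so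
   vanishes too. *)
have [G0|G0] := eqVneq (Gall x t) 0.
  have -> : Gupto prec x t j = 0; last by rewrite mulr0.
  by apply/eqP; rewrite eq_le Gupto_ge0 -G0 Gupto_le_Gall.
have Gk0 : 0 < Gall x t ^+ k by rewrite exprn_gt0// lt_neqAle eq_sym G0 Gall_ge0.
rewrite rates// /rate mulrAC ler_pdivrMr// mulrC.
(* The increment from [Gadjacent] to [Gupto] is the marginal of [j]; the remaining power of [Gupto]
   is absorbed by the denominator. *)
apply: le_trans (subX_le_mul k (Gadjacent_ge0 pj) (Gadjacent_le_Gupto pj)) _.
rewrite Gupto_marginalD// addrK -Gupto_marginalD//; apply: ler_wpM2l => //.
by apply: lerXn2r; rewrite ?nnegrE ?Gupto_ge0 ?Gall_ge0 ?Gupto_le_Gall.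
Qed.

(** Once the work equals the volume, the job is no longer pending and its rate is 0. *)
Lemma work_le_volume j t : release j <= t -> work x j t <= volume j.
Proof.
move=> rt; rewrite leNgt; apply/negP => lt_w.
have [c /andP[rc ct] wc] := work_reaches x_feas rt (ltW lt_w).
have zero : \int[mu]_(u in `[c, t]) x j u <= 0.
  rewrite -(mul0r (t - c)) -integral_cst//; apply: integral_le.
  - exact: bounded_mfun_schedule x_feas j.
  - exact: bounded_mfun_cst.
  move=> u /andP[cu ut]; have [-> //] := x_rates u.
  rewrite /pending (le_trans rc cu) /= -leNgt -wc.
  exact: (work_nondecreasing x_feas).
by move: lt_w; rewrite (workD x_feas rc ct) wc ltNge gerDl zero.
Qed.

(** If [j] were still pending at [T], the machine would run at full speed from [r] to [T] and do
    work equal to the total volume. But no job absorbs more than its volume, and [j] absorbs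
    strictly less. *)
Lemma run_completes : completes x.
Proof.
move=> j.
(* As releases are nonnegative, their sum bounds each of them. *)
pose r := \sum_(a : job I) release a; pose T := r + \sum_(a : job I) volume a.
have rr a : release a <= r.
  by rewrite /r (bigD1 a)//= lerDl sumr_ge0// => b _; exact: release_ge0.
have rT : r <= T.
  by rewrite lerDl sumr_ge0// => b _; exact/ltW/volume_gt0.
have rjT := le_trans (rr j) rT.
suff vT : volume j <= work x j T.
  have [c /andP[rc _] wc] := work_reaches x_feas rjT vT.
  by exists c.
rewrite leNgt; apply/negP => lt_v.
have pT : pending x T j by rewrite /pending rjT.
have : \int[mu]_(u in `[r, T]) (\sum_a x a u) = T - r.
  rewrite -[RHS]mul1r -integral_cst//; apply: eq_Rintegral => u.
  rewrite inE /= in_itv /= => /andP[ru uT]; apply: (@full_speed u j).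
  exact: (pending_before x_feas (le_trans (rr j) ru) uT pT).
rewrite integral_sum; last exact: bounded_mfun_schedule x_feas.
rewrite /T addrAC subrr add0r => /eqP; apply/negP; rewrite lt_eqF//.
have wle a : \int[mu]_(u in `[r, T]) x a u <= work x a T.
  rewrite (workD x_feas (rr a) rT) lerDr integral_ge0// => u _.
  exact: (schedule_ge0 x_feas).
rewrite (bigD1 j)//= [X in _ < X](bigD1 j)//=; apply: ltr_leD.
  exact: le_lt_trans (wle j) lt_v.
apply: ler_sum => a _; apply: le_trans (wle a) _.
exact/work_le_volume/le_trans/rT.
Qed.

End Run.

(** * The dual solution and the comparison of costs *)

Section DualFitting.
Variables (R : realType) (I : instance R) (k : nat) (prec : rel (job I)).
Variable x : job I -> R -> R.
Hypotheses (k_gt0 : (0 < k)%N) (I_concave : concave_instance I)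
  (x_feas : feasible 1 x) (prec_order : release_order prec)
  (x_rates : follows_rates prec k x).
Implicit Types (j a : job I) (t u v : R).
Local Notation mu := (@lebesgue_measure R).

(* Agrees with [marginal] after the release and is bounded and monotone on the
   whole line, unlike [marginal] whose values before the release are junk. *)
Let slope a t : R :=
  weight a * deriv_nonneg (fcost a) (Num.max 0 (t - release a)).

Let slope_marginal a t : release a <= t -> slope a t = marginal a t.
Proof. by move=> rt; rewrite /slope max_r// subr_ge0. Qed.

Let slope_ge0 a t : 0 <= slope a t.
Proof.
have [conc diff] := I_concave a.
apply: mulr_ge0; first exact/ltW/weight_gt0.
apply: deriv_nonneg_ge0 => //; first exact: fcost_nondecreasing.
by rewrite le_max lexx.
Qed.

Let bounded_mfun_slope a : bounded_mfun (slope a).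
Proof.
have [conc diff] := I_concave a.
apply: bounded_mfunM; first exact: bounded_mfun_cst.
exact: bounded_mfun_deriv (@fcost_nondecreasing _ _ a) _.
Qed.

Let integral_slope a t : release a <= t ->
  \int[mu]_(u in `[release a, t]) slope a u =
  weight a * fcost a (t - release a).
Proof.
have [conc diff] := I_concave a.
move=> rt; rewrite integralZ; last first.
  exact: bounded_mfun_deriv (@fcost_nondecreasing _ _ a) _.
rewrite integral_deriv// ?subrr ?fcost_at0 ?subr0//.
exact: fcost_nondecreasing.
Qed.

Let pending_slope a t : R := \1_[set u | pending x u a] t * slope a t.

Let bounded_mfun_pending_slope a : bounded_mfun (pending_slope a).
Proof.
apply: bounded_mfunM => //; apply: bounded_mfun_indic.
exact: measurable_pending x_feas a.
Qed.

Let pending_slope_ge0 a t : 0 <= pending_slope a t.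
Proof. by rewrite mulr_ge0. Qed.

Let pending_slopeE a t :
  pending_slope a t = if pending x t a then marginal a t else 0.
Proof.
rewrite /pending_slope indicE.
have [pa|npa] := boolP (pending x t a).
  rewrite (_ : t \in _) ?mul1r; last by rewrite inE.
  by rewrite slope_marginal//; case/andP: pa.
rewrite (_ : (t \in _) = false) ?mul0r//.
by apply/negbTE; rewrite notin_setE/=; exact/negP.
Qed.

Let GallE t : Gall x t = \sum_a pending_slope a t.
Proof.
by rewrite /Gall big_mkcond/=; apply: eq_bigr => a _; rewrite pending_slopeE.
Qed.

Let GuptoE t j : Gupto prec x t j = \sum_(a | prec a j) pending_slope a t.
Proof.
rewrite /Gupto big_mkcond/= [RHS]big_mkcond/=; apply: eq_bigr => a _.
by rewrite pending_slopeE; case: (pending x t a); case: (prec a j).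
Qed.

Let bounded_mfun_Gall : bounded_mfun (Gall x).
Proof.
rewrite (_ : Gall x = fun t => \sum_a pending_slope a t); last exact/funext/GallE.
exact: bounded_mfun_sum.
Qed.

Let dual_rate j t : R := x j t * Gupto prec x t j.

Let bounded_mfun_dual_rate j : bounded_mfun (dual_rate j).
Proof.
apply: bounded_mfunM; first exact: bounded_mfun_schedule x_feas j.
rewrite (_ : (fun t => _) = fun t => \sum_(a | prec a j) pending_slope a t).
  exact: bounded_mfun_sum.
by apply/funext => t; rewrite GuptoE.
Qed.

Let dual_rate_not_pending j t : ~~ pending x t j -> dual_rate j t = 0.
Proof.
by have [H _ _] := x_rates t => /H; rewrite /dual_rate => ->; rewrite mul0r.
Qed.

(** Jobs preceding [j] are released by time [t], so those pending at [u] were pending at [t]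
    already, with marginals at least as large by concavity. *)
Lemma Gupto_decay j t u : release j <= t -> t <= u ->
  Gupto prec x u j <= Gall x t.
Proof.
move=> rt tu; apply: le_trans (Gupto_le_Gall prec x I_concave t j).
rewrite !GuptoE; apply: ler_sum => a aj.
rewrite !pending_slopeE; case: ifPn => [pu|_]; last first.
  by case: ifPn => // /(pending_marginal_ge0 I_concave).
have ra : release a <= t.
  by case: prec_order => _ _ _ /(_ _ _ aj) raj; exact: le_trans raj rt.
rewrite (pending_before x_feas ra tu pu).
exact: marginal_nonincreasing.
Qed.

(** The price lam_j, with a finite horizon [M] that will lie beyond all completion times. *)
Definition dual_price (M : R) j : R :=
  \int[mu]_(t in `[release j, M]) (x j t * Gupto prec x t j).

(* Before [t] the rate [x_j G_j] is at most [k] times the cost slope of [j];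
   after [t] the factor [G_j] never exceeds [G t], as only jobs released before
   [j] contribute to it. *)
Lemma dual_price_le M j t : release j <= t -> t <= M ->
  dual_price M j <=
  k%:R * (weight j * fcost j (t - release j)) + volume j * Gall x t.
Proof.
move=> rt tM; rewrite /dual_price (integral_split (bounded_mfun_dual_rate j) rt tM).
apply: lerD.
  rewrite -integral_slope// -integralZ//.
  apply: integral_le => //.
    by apply: bounded_mfunM => //; exact: bounded_mfun_cst.
  move=> u /andP[ru _]; have [pu|npu] := boolP (pending x u j).
    by rewrite slope_marginal//; exact: (dual_rate_le I_concave prec_order).
  by rewrite -/(dual_rate j u) dual_rate_not_pending// mulr_ge0.
have bx := bounded_mfun_schedule x_feas j.
apply: (@le_trans _ _ (\int[mu]_(u in `[t, M]) (Gall x t * x j u))).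
  apply: integral_le => //.
    by apply: bounded_mfunM => //; exact: bounded_mfun_cst.
  move=> u /andP[tu _]; rewrite [leRHS]mulrC ler_wpM2l ?(schedule_ge0 x_feas)//.
  exact: Gupto_decay.
rewrite integralZ// mulrC ler_wpM2r ?(Gall_ge0 _ I_concave)//.
apply: le_trans (work_le_volume x_feas x_rates (le_trans rt tM)).
rewrite (workD x_feas rt tM) lerDr integral_ge0// => u _.
exact: schedule_ge0 x_feas _ _.
Qed.

Lemma sum_dual_price_ge M : (forall j, release j <= M) ->
  k%:R * \int[mu]_(t in `[0, M]) Gall x t <= k.+1%:R * \sum_j dual_price M j.
Proof.
move=> rM.
have bk c f : bounded_mfun f -> bounded_mfun (fun t : R => c * f t : R).
  by move=> bf; apply: bounded_mfunM => //; exact: bounded_mfun_cst.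
have bs : bounded_mfun (fun t => \sum_j dual_rate j t) by exact: bounded_mfun_sum.
apply: (@le_trans _ _ (k.+1%:R * \int[mu]_(t in `[0, M]) (\sum_j dual_rate j t))).
  rewrite -!integralZ//; apply: integral_le; [exact: bk|exact: bk|].
  by move=> t _; exact: (sum_dual_rates_ge I_concave x_feas prec_order).
rewrite ler_wpM2l// integral_sum//; apply: ler_sum => j _.
rewrite (integral_split (bounded_mfun_dual_rate j) (release_ge0 j) (rM j)).
rewrite -[leRHS]add0r; apply: lerD => //.
(* Nothing accrues before the release; at the release itself [j] may be pending, hence the
   comparison on the open interval. *)
apply: (@le_trans _ _ (\int[mu]_(t in `[0, release j]) (0 : R))); last first.
  by rewrite integral_cst ?mul0r ?release_ge0.
apply: integral_le_oo => //; first exact: bounded_mfun_cst.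
move=> t /andP[_ tr]; rewrite dual_rate_not_pending//.
by rewrite /pending leNgt tr.
Qed.

(** The cost of [j] is the integral of its slope from release to completion. It is pending
    throughout, except at the completion time itself, so the slope is part of [Gall] there. *)
Lemma total_cost_le M : completes x -> (forall j, completion x j <= M) ->
  total_cost x <= \int[mu]_(t in `[0, M]) Gall x t.
Proof.
move=> x_comp CM.
rewrite (_ : Gall x = fun t => \sum_a pending_slope a t); last exact/funext/GallE.
rewrite integral_sum//; apply: ler_sum => j _.
have rC := release_le_completion (x_comp j).
rewrite -integral_slope//.
apply: (@le_trans _ _
  (\int[mu]_(t in `[release j, completion x j]) pending_slope j t)).
  apply: integral_le_oo => // t /andP[rt tC].
  have rt' := ltW rt; rewrite pending_slopeE slope_marginal// ifT//.
  rewrite /pending rt' /= ltNge; apply/negP => vt.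
  have [c /andP[rc ct] wc] := work_reaches x_feas rt' vt.
  have := completion_lbound (conj rc wc).
  by apply/negP; rewrite -ltNge (le_lt_trans ct).
by apply: integral_extend => //; exact: release_ge0.
Qed.

Section Offline.
Variables (s : R) (y : job I -> R -> R).
Hypotheses (y_feas : feasible s y) (y_comp : completes y).

Lemma sum_dual_price_le M : (forall j, completion y j <= M) ->
  \sum_j dual_price M j <=
  k%:R * total_cost y + s * \int[mu]_(t in `[0, M]) Gall x t.
Proof.
move=> CM.
have by_ j := bounded_mfun_schedule y_feas j.
have bGy j : bounded_mfun (fun t => Gall x t * y j t) by exact: bounded_mfunM.
have Gy0 j t : 0 <= Gall x t * y j t.
  by rewrite mulr_ge0 ?(Gall_ge0 _ I_concave)// (schedule_ge0 y_feas).
apply: (@le_trans _ _ (\sum_j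
  (k%:R * (weight j * fcost j (completion y j - release j)) +
   \int[mu]_(t in `[0, M]) (Gall x t * y j t)))).
  apply: ler_sum => j _.
  have [rC wC] := completion_attained y_feas (y_comp j).
  set C := completion y j in rC wC *; set c := k%:R * _.
  (* The dual constraint is weighted by [y j t] and integrated up to the completion time [C] in [y],
     where the total weight is the volume of [j]. Monotonicity of the cost function replaces the
     delay at [t] by the delay at [C]. *)
  have lam : dual_price M j * volume j <= \int[mu]_(t in `[release j, C])
      (c * y j t + volume j * (Gall x t * y j t)).
    rewrite -{1}wC /work -integralZ//; apply: integral_le.
    - by apply: bounded_mfunM => //; exact: bounded_mfun_cst.
    - by apply: bounded_mfunD; apply: bounded_mfunM => //; exact: bounded_mfun_cst.
    move=> t /andP[rt tC]; rewrite mulrA -mulrDl.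
    rewrite ler_wpM2r ?(schedule_ge0 y_feas)//.
    apply: le_trans (dual_price_le rt (le_trans tC (CM j))) _.
    rewrite lerD2r /c; apply: ler_wpM2l => //; apply: ler_wpM2l.
      exact/ltW/weight_gt0.
    by apply: fcost_nondecreasing; rewrite ?subr_ge0// lerD2r.
  rewrite -(ler_pM2r (volume_gt0 j)); apply: le_trans lam _.
  rewrite integralD; [|by apply: bounded_mfunM => //; exact: bounded_mfun_cst..].
  rewrite !integralZ// [X in c * X]wC mulrDl lerD2l mulrC ler_wpM2r//.
    exact/ltW/volume_gt0.
  by apply: integral_extend => //; [exact: release_ge0|exact: CM].
rewrite big_split/= /total_cost mulr_sumr lerD2l -integral_sum// -integralZ//.
apply: integral_le.
- exact: bounded_mfun_sum.
- by apply: bounded_mfunM => //; exact: bounded_mfun_cst.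
(* Summed over jobs, the offline rates at time [t] are at most [s]. *)
move=> t _; rewrite -mulr_sumr mulrC ler_wpM2r ?(Gall_ge0 _ I_concave)//.
by case: y_feas.
Qed.

End Offline.

Lemma run_cost_le (s : R) (y : job I -> R -> R) : feasible s y -> completes y ->
  0 <= k%:R - k.+1%:R * s ->
  (k%:R - k.+1%:R * s) * total_cost x <= k.+1%:R * k%:R * total_cost y.
Proof.
move=> y_feas y_comp gap.
have x_comp := run_completes k_gt0 x_feas prec_order x_rates.
(* A common horizon: completion times are nonnegative, so the sum bounds each of them in both
   schedules. *)
pose M := \sum_j (completion x j + completion y j).
have Cx0 j : 0 <= completion x j.
  exact: le_trans (release_ge0 j) (release_le_completion (x_comp j)).
have Cy0 j : 0 <= completion y j.
  exact: le_trans (release_ge0 j) (release_le_completion (y_comp j)).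
have CM j : completion x j + completion y j <= M.
  by rewrite /M (bigD1 j)//= lerDl sumr_ge0// => a _; rewrite addr_ge0.
have xM j : completion x j <= M by apply: le_trans (CM j); rewrite lerDl.
have yM j : completion y j <= M by apply: le_trans (CM j); rewrite lerDr.
have rM j : release j <= M.
  exact: le_trans (release_le_completion (x_comp j)) (xM j).
(* With a nonnegative [gap], the cost may be replaced by the larger integral of [Gall]; the two
   bounds on the sum of the prices then combine. *)
apply: le_trans (ler_wpM2l gap (total_cost_le x_comp xM)) _.
rewrite mulrBl lerBlDr -[X in _ + X]mulrA -mulrA -mulrDr.
apply: le_trans (sum_dual_price_ge rM) _.
by rewrite ler_wpM2l// (sum_dual_price_le y_feas y_comp yM).
Qed.

End DualFitting.

(** * The choice of [k] and the resulting ratio *)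

Lemma competitive_ratio_le (R : realFieldType) (eps k : R) :
  0 < eps -> 2 / eps <= k -> k < 2 / eps + 1 ->
  (k + 1) * k * eps ^+ 2 <=
  (k - (k + 1) * (1 + eps)^-1) * (4 * (1 + eps) ^+ 2).
Proof.
move=> e0 lo hi; have e1 : 1 + eps != 0 by rewrite gt_eqF// addr_gt0.
have -> : (k - (k + 1) * (1 + eps)^-1) * (4 * (1 + eps) ^+ 2) =
  4 * (1 + eps) * (k * eps - 1) by field.
move: lo hi; rewrite ler_pdivrMr// -ltrBlDr ltr_pdivlMr// mulrBl mul1r.
(* The claim becomes [u * (u + eps) <= 4 * (1 + eps) * (u - 1)] for [u] between [2] and [2 + eps].
   The left side is convex in [u], the right side is affine, and the inequality holds at both
   ends. *)
set u := k * eps.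
have -> : (k + 1) * k * eps ^+ 2 = u * (u + eps) by rewrite /u; ring.
by move=> lo hi; nra.
Qed.

Theorem theorem24 (R : realType) (eps : R) (eps_gt0 : 0 < eps) :
  speed_competitive (@concave_instance R)
    (@rate_algorithm R `|Num.ceil (2 / eps)|%N)
    (1 + eps) (4 * (1 + eps) ^+ 2 / eps ^+ 2).
Proof.
move=> I I_concave x [x_feas [prec [prec_order x_rates]]].
set k := `|_|%N in x_rates.
have e2 : 0 < 2 / eps by rewrite divr_gt0.
have kE : k%:R = (Num.ceil (2 / eps))%:~R :> R.
  by rewrite /k natr_absz gtr0_norm// ceil_gt0.
have k_gt0 : (0 < k)%N by rewrite absz_gt0 gt_eqF// ceil_gt0.
have lo : 2 / eps <= k%:R by rewrite kE ceil_ge.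
have hi : k%:R < 2 / eps + 1.
  by rewrite kE -ltrBlDr; have := ceilB1_lt (2 / eps); rewrite intrB.
have ratio := competitive_ratio_le eps_gt0 lo hi.
have c0 : 0 < 4 * (1 + eps) ^+ 2 by rewrite mulr_gt0// exprn_gt0// addr_gt0.
(* Positivity is read off [ratio], whose left side is positive. *)
have gap : 0 < k%:R - k.+1%:R * (1 + eps)^-1.
  rewrite -natr1 -(pmulr_lgt0 _ c0); apply: lt_le_trans ratio.
  by rewrite !mulr_gt0 ?exprn_gt0// ?ltr0n// natr1 ltr0n.
split; first exact: run_completes k_gt0 x_feas prec_order x_rates.
have b0 : 0 < 4 * (1 + eps) ^+ 2 / eps ^+ 2 by rewrite divr_gt0// exprn_gt0.
(* Dividing by the ratio makes the claim a lower bound on the infimum, to be checked on each offline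
   schedule [y]. *)
rewrite -lee_pdivrMl//; apply: le_ereal_inf_tmp => _ [y [y_feas y_comp] <-].
rewrite -EFinM lee_fin mulrC ler_pdivrMr//.
have := run_cost_le k_gt0 I_concave x_feas prec_order x_rates y_feas y_comp
  (ltW gap).
have y0 : 0 <= total_cost y.
  apply: sumr_ge0 => j _; apply: mulr_ge0; first exact/ltW/weight_gt0.
  by apply: fcost_ge0; rewrite subr_ge0 release_le_completion.
move=> H; rewrite -(ler_pM2l gap); apply: le_trans H _.
rewrite mulrCA [leRHS]mulrC; apply: ler_wpM2r => //.
rewrite mulrA ler_pdivlMr ?exprn_gt0//; by move: ratio; rewrite natr1.
Qed.
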